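(* Let $A=(a_{ij})\in\mathbb{R}_{\max}^{n\times n}$ be a matrix with a tropical algebraic eigenvalue $\lambda\in\mathbb{R}_{\max}$, such that $a_{ii}\le\lambda$ for all $i\in[n]$. (1) If $p,q\in[n]$ satisfy $a_{pq}\ge\lambda$ and $a_{pq}\ge a_{qp}$, define $x=(x_i)\in\mathbb{R}_{\max}^n$ by $x_p=0$, $x_q=\lambda-a_{pq}$, and $x_i=\varepsilon$ for $i\in[n]\setminus\{p,q\}$. (2) If $p,q\in[n]$ satisfy $a_{pq}\ge\lambda$ and $a_{qp}\ge a_{pq}$, define $x=(x_i)\in\mathbb{R}_{\max}^n$ by $x_q=0$, $x_p=\lambda-a_{qp}$, and $x_i=\varepsilon$ for $i\in[n]\setminus\{p,q\}$. In both cases, $x$ is a generalized tropical eigenvector in $\mathbb{R}_{\max}^n$ associated with $\lambda$, with $\Vert x\Vert=0$.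
   Context: $\mathbb{R}_{\max}=\mathbb{R}\cup\{-\infty\}$ is the tropical (max-plus) semiring with $a\oplus b=\max\{a,b\}$, $a\otimes b=a+b$, and additive neutral element $\varepsilon=-\infty$ (absorbing for $\otimes$); the tropical inverse of a non-$\varepsilon$ element $a$ is $a^{\otimes -1}=-a$. Write $[n]=\{1,\dots,n\}$. Matrix and vector operations are defined as in classical linear algebra with $(\oplus,\otimes)$ in place of $(+,\times)$; in particular $x^T\otimes A\otimes x=\max_{i,j\in[n]}(x_i+a_{ij}+x_j)$ and $x^T\otimes x=2\max_i x_i$. Tropical algebraic eigenvalues: the tropical characteristic polynomial of $A=(a_{ij})\in\mathbb{R}_{\max}^{n\times n}$ is the formal polynomial $P_A(X)=\mathrm{per}(A\oplus X\otimes I)=\bigoplus_{k=0}^n c_{n-k}\otimes X^{\otimes k}$, where $I$ is the tropical identity matrix ($0$ on the diagonal, $\varepsilon$ elsewhere), $c_0=0$, and for $1\le m\le n$, $c_m=\max_{J\subseteq[n],|J|=m}\ \max_{\sigma\in \mathrm{Sym}(J)}\sum_{i\in J}a_{i\sigma(i)}$. The tropical roots of a formal polynomial $P$ are: the points of $\mathbb{R}$ at which the maximum in the associated polynomial function is attained by at least two distinct monomials, and additionally $\varepsilon$ if $P$ has no constant term (i.e. its constant coefficient is $\varepsilon$). The tropical algebraic eigenvalues of $A$ are the tropical roots of $P_A$. A generalized tropical eigenvector of $A$ associated with a tropical algebraic eigenvalue $\lambda$ is a vector $x\in\mathbb{R}_{\max}^n$, $x\neq(\varepsilon,\ldots,\varepsilon)^T$,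 with $x^T\otimes A\otimes x=\lambda\otimes x^T\otimes x$. For $v\in\mathbb{R}_{\max}^n$, $v\neq(\varepsilon,\ldots,\varepsilon)^T$, $\Vert v\Vert=\max\{v_1,\ldots,v_n\}$. *)

(* Defs.v *)
From HB Require Import structures.
From mathcomp Require Import all_boot all_order all_algebra.
From mathcomp Require Import all_fingroup reals constructive_ereal.

Set Implicit Arguments.
Unset Strict Implicit.
Unset Printing Implicit Defensive.

Import Order.TTheory GRing.Theory Num.Theory.

Local Open Scope ring_scope.

(** Max-plus semiring: the extended reals other than [+oo], with the order
    inherited from [\bar R].  The ring operations on [maxplus R] are the
    tropical ones: [a + b] is max(a, b), [a * b] is the usual sum, [0] is
    epsilon = -oo, and [1] is the real number zero. *)
Record maxplus (R : realType) := MaxPlus {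
  mpval : \bar R;
  mpval_neqy : mpval != +oo%E
}.
Arguments MaxPlus {R}.

HB.instance Definition _ (R : realType) := [isSub for @mpval R].
HB.instance Definition _ (R : realType) := [Choice of maxplus R by <:].
HB.instance Definition _ (R : realType) :=
  [SubChoice_isSubOrder of maxplus R by <: with ring_display].

Section Semiring.
Variable R : realType.
Implicit Types a b c : maxplus R.

Definition mpeps : maxplus R := @MaxPlus R -oo%E isT.

Definition mpfin (r : R) : maxplus R := @MaxPlus R r%:E isT.

Fact mpadd_subproof a b : Order.max (mpval a) (mpval b) != +oo%E.
Proof. by case: a b => [x hx] [y hy]; rewrite /= /Order.max; case: ifP. Qed.

Fact mpmul_subproof a b : (mpval a + mpval b)%E != +oo%E.
Proof. by case: a b => [[x||] hx] [[y||] hy]. Qed.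

Definition mpadd a b : maxplus R :=
  MaxPlus (Order.max (mpval a) (mpval b)) (mpadd_subproof a b).

Definition mpmul a b : maxplus R :=
  MaxPlus (mpval a + mpval b)%E (mpmul_subproof a b).

Fact mpaddA : associative mpadd.
Proof. by move=> a b c; apply/val_inj; rewrite /= maxA. Qed.

Fact mpaddC : commutative mpadd.
Proof. by move=> a b; apply/val_inj; rewrite /= maxC. Qed.

Fact mpadd0 : left_id mpeps mpadd.
Proof. by move=> a; apply/val_inj; rewrite /= maxNye. Qed.

Fact mpmulA : associative mpmul.
Proof. by move=> a b c; apply/val_inj; rewrite /= addeA. Qed.

Fact mpmulC : commutative mpmul.
Proof. by move=> a b; apply/val_inj; rewrite /= addeC. Qed.

Fact mpmul1 : left_id (mpfin 0) mpmul.
Proof. by move=> a; apply/val_inj; rewrite /= add0e. Qed.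

Fact mpmulDl : left_distributive mpmul mpadd.
Proof. by move=> a b c; apply/val_inj; rewrite /= adde_maxl. Qed.

Fact mpmul0 : left_zero mpeps mpmul.
Proof. by move=> a; apply/val_inj. Qed.

Fact mp1_neq0 : mpfin 0 != mpeps.
Proof. by []. Qed.

End Semiring.

HB.instance Definition _ (R : realType) :=
  GRing.isNmodule.Build (maxplus R) (@mpaddA R) (@mpaddC R) (@mpadd0 R).
HB.instance Definition _ (R : realType) :=
  GRing.Nmodule_isComNzSemiRing.Build (maxplus R)
    (@mpmulA R) (@mpmulC R) (@mpmul1 R) (@mpmulDl R) (@mpmul0 R) (@mp1_neq0 R).

Section Tropical.
Variable R : realType.
Local Notation T := (maxplus R).

(** The inverse of epsilon does not exist; the value epsilon is a dummy.  It
    does not affect [lam * mpinv a] with [lam <= a]: if [a] is epsilon, so is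
    [lam], which absorbs. *)
Definition mpinv (a : T) : T :=
  if mpval a is r%:E%E then mpfin (- r) else mpeps R.

Definition permanent (S : comNzSemiRingType) n (M : 'M[S]_n) : S :=
  \sum_(s : 'S_n) \prod_(i < n) M i (s i).

Definition tropical_charpoly n (A : 'M[T]_n) : {poly T} :=
  permanent (map_mx polyC A + 'X *: 1%:M).

(** The semiring zero is epsilon, so [P`_k != mpeps R] says that the monomial
    of degree [k] occurs in [P], and [P.[x]] is the maximum of its monomials
    at [x]. *)
Definition tropical_root (P : {poly T}) (lam : T) : Prop :=
  (lam != mpeps R /\
     exists i j : nat,
       [/\ i != j, P`_i != mpeps R, P`_j != mpeps R,
           P`_i * lam ^+ i = P.[lam] & P`_j * lam ^+ j = P.[lam]])
  \/ (lam = mpeps R /\ P`_0 = mpeps R).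

Definition tropical_alg_eigenvalue n (A : 'M[T]_n) (lam : T) : Prop :=
  tropical_root (tropical_charpoly A) lam.

Definition generalized_eigenvector n (A : 'M[T]_n) (lam : T) (x : 'cV[T]_n) :
    Prop :=
  x != const_mx (mpeps R) /\ x^T *m A *m x = lam *: (x^T *m x).

Definition tropical_norm n (v : 'cV[T]_n) : T :=
  \big[Order.max/mpeps R]_(i < n) v i 0.

(** When [p = q] the entry is the real number zero and [t] is ignored: for
    [t = lam * mpinv (A p p)] with [lam <= A p p <= lam] and [lam] finite,
    [t] is that number anyway. *)
Definition two_point_vector n (p q : 'I_n) (t : T) : 'cV[T]_n :=
  \col_i (if i == p then mpfin 0 else if i == q then t else mpeps R).

End Tropical.

Arguments mpeps {R}.

(* Main.v *)
(** Write t = lam - a_pq <= 0.  For p <> q, the terms of x^T A x other than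
    epsilon are among a_pp, a_pq + t, a_qp + t and a_qq + 2t.  The second equals
    lam and the others are at most lam, while x^T x = max(0, 2t) = 0.  For p = q
    the only term is a_pp = lam.  The second part is the first one with p and q
    exchanged, since there lam <= a_pq <= a_qp. *)
Require Import Defs.
From mathcomp Require Import all_boot all_order all_algebra.
From mathcomp Require Import all_fingroup reals constructive_ereal.

Import Order.TTheory GRing.Theory.

Local Open Scope ring_scope.

Lemma maxplus_leE (R : realType) (a b : maxplus R) :
  (a <= b) = (mpval a <= mpval b)%E.
Proof. by []. Qed.

Lemma maxplus_addE (R : realType) (a b : maxplus R) : a + b = Order.max a b.
Proof.
apply/val_inj; rewrite /= /Order.max -[(mpval a < mpval b)%E]/(a < b).
by case: ifP.
Qed.

Lemma maxplus_ge0 (R : realType) (a : maxplus R) : (0 : maxplus R) <= a.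
Proof. by rewrite maxplus_leE leNye. Qed.

Lemma maxplus_leM (R : realType) (a b c d : maxplus R) :
  a <= b -> c <= d -> a * c <= b * d.
Proof. by rewrite !maxplus_leE; exact: leeD. Qed.

(** Tropical addition is a maximum, so a sum is evaluated by exhibiting one dominating index. The
    norm, [x^T *m x] and [x^T *m A *m x] are all computed this way. *)
Lemma maxplus_sum_attained (R : realType) (I : finType) (F : I -> maxplus R)
    (i0 : I) :
  (forall i, F i <= F i0) -> \sum_i F i = F i0.
Proof.
move=> leF; rewrite (bigD1 i0) //= maxplus_addE; apply: max_idPl.
elim/big_ind: _ => [|a b ha hb|//]; first exact: maxplus_ge0.
by rewrite maxplus_addE ge_max ha.
Qed.

Lemma tropical_normE (R : realType) (n : nat) (v : 'cV[maxplus R]_n) :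
  tropical_norm v = \sum_i v i 0.
Proof.
by apply: (big_ind2 eq) => // a b c d -> ->; rewrite maxplus_addE.
Qed.

(** For finite [a] this is cancellation; if [a] is epsilon, then so is [lam], and both sides are
    epsilon. *)
Lemma maxplus_mul_mpinv (R : realType) (lam a : maxplus R) :
  lam <= a -> a * (lam * mpinv a) = lam.
Proof.
rewrite maxplus_leE /mpinv; case: a lam => [[a||] ha] [[l||] hl] //= lea;
  apply/val_inj => //=.
by congr _%:E; rewrite addrC subrK.
Qed.

Lemma maxplus_mul_mpinv_le1 (R : realType) (lam a : maxplus R) :
  lam <= a -> lam * mpinv a <= 1.
Proof.
rewrite !maxplus_leE /mpinv; case: a lam => [[a||] ha] [[l||] hl] //=;
  rewrite ?leNye // !lee_fin.
by rewrite Num.Theory.subr_le0.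
Qed.

Lemma two_point_generalized_eigenvector (R : realType) (n : nat)
    (A : 'M[maxplus R]_n) (lam : maxplus R) (p q : 'I_n) :
  (forall i : 'I_n, A i i <= lam) -> lam <= A p q -> A q p <= A p q ->
  let x := two_point_vector p q (lam * mpinv (A p q)) in
  generalized_eigenvector A lam x /\ tropical_norm x = mpfin 0.
Proof.
move=> hdiag le_pq le_qp /=.
set t := lam * _; set x := two_point_vector p q t.
have tpq : A p q * t = lam by exact: maxplus_mul_mpinv.
have t1 : t <= 1 by exact: maxplus_mul_mpinv_le1.
have xE i : x i 0 = if i == p then 1 else if i == q then t else 0.
  by rewrite mxE.
have xp : x p 0 = 1 by rewrite xE eqxx.
have x1 i : x i 0 <= 1.
  by rewrite xE; case: ifP => // _; case: ifP; rewrite ?maxplus_ge0.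
(* If [q = p], the entry [x q 0] is [1] instead of [t], and the equality comes from
   [lam <= A p p <= lam]. *)
have pqE : x p 0 * A p q * x q 0 = lam.
  rewrite xp mul1r xE; case: (eqVneq q p) => [eqp|_]; last by rewrite eqxx.
  by rewrite mulr1; apply: le_anti; rewrite le_pq eqp hdiag.
have term_le i j : x i 0 * A i j * x j 0 <= lam.
  (* Diagonal terms need only [x1] and [hdiag], whichever index [k] is. *)
  have diag_le k : x k 0 * A k k * x k 0 <= lam.
    have : x k 0 * A k k * x k 0 <= 1 * lam * 1 by rewrite !maxplus_leM.
    by rewrite mul1r mulr1.
  case: (eqVneq i j) => [->//|].
  rewrite !xE; case: (eqVneq i p) => [->|_]; case: (eqVneq j p) => [->|_];
    rewrite ?eqxx // => neq.
  - case: (eqVneq j q) => [->|_]; rewrite ?mulr0 ?maxplus_ge0 //.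
    by rewrite mul1r tpq.
  (* For the transposed pair, [A q p * t <= A p q * t = lam]. *)
  - case: (eqVneq i q) => [->|_]; rewrite ?mul0r ?maxplus_ge0 //.
    by rewrite mulr1 mulrC -[leRHS]tpq maxplus_leM.
  (* Distinct indices that both avoid [p] cannot both be [q], so one factor is epsilon. *)
  - case: (eqVneq i q) => [eiq|_]; last by rewrite !mul0r maxplus_ge0.
    by rewrite -eiq [j == i]eq_sym (negPf neq) mulr0 maxplus_ge0.
split; last first.
  by rewrite tropical_normE (@maxplus_sum_attained _ _ _ p) xp.
split.
  by apply/eqP => /matrixP/(_ p 0); rewrite xp mxE => /eqP.
apply/matrixP => i j; rewrite !ord1 !mxE.
have -> : \sum_k x^T 0 k * x k 0 = 1.
  rewrite (@maxplus_sum_attained _ _ _ p) => [|k]; rewrite ![x^T _ _]mxE xp ?mulr1 //.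
  by rewrite -[leRHS]mulr1 maxplus_leM.
rewrite mulr1.
under eq_bigr do rewrite mxE mulr_suml.
(* The outer sum runs over the columns of [A], so the pair [(q, p)] denotes the term with
   [A p q]. *)
rewrite pair_big /= (@maxplus_sum_attained _ _ _ (q, p)) /= => [|[k l]] /=.
  by rewrite mxE pqE.
by rewrite ![x^T _ _]mxE pqE.
Qed.

Theorem theorem5p1 (R : realType) (n : nat) (A : 'M[maxplus R]_n)
    (lam : maxplus R)
    (hlam : tropical_alg_eigenvalue A lam)
    (hdiag : forall i : 'I_n, A i i <= lam) :
  (forall p q : 'I_n, lam <= A p q -> A q p <= A p q ->
     let x := two_point_vector p q (lam * mpinv (A p q)) in
     generalized_eigenvector A lam x /\ tropical_norm x = mpfin 0) /\
  (forall p q : 'I_n, lam <= A p q -> A p q <= A q p ->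
     let x := two_point_vector q p (lam * mpinv (A q p)) in
     generalized_eigenvector A lam x /\ tropical_norm x = mpfin 0).
Proof.
split=> p q le_pq ?; first exact: two_point_generalized_eigenvector.
by apply: two_point_generalized_eigenvector => //; apply: le_trans le_pq _.
Qed.
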